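(* Let $(M,g)$ be an $n$-dimensional Riemannian manifold, $n\geq 3$, possibly with boundary, with $g\in C^r$, $r>2$. Let $Z=(Z^1,\ldots,Z^n)$ be coordinates on an open set $\Omega\subset M$. Then $Z$ are conformal harmonic coordinates on $\Omega$ if and only if the contracted Christoffel symbols $\Gamma_a$, $a=1,\ldots,n$, of $g$ in the coordinates $Z$ satisfy $$\Gamma_a=2\,\partial_a\log f$$ for some positive function $f$ on $\Omega$ that satisfies $L_gf=0$.
   Context: Christoffel symbols $\Gamma_{ab}^c=\frac12g^{cd}(\partial_ag_{bd}+\partial_bg_{ad}-\partial_dg_{ab})$; contracted Christoffel symbols $\Gamma^a=g^{bc}\Gamma_{bc}^a$ and $\Gamma_a=g_{ab}\Gamma^b$. $L_g=\Delta_g+\frac{n-2}{4(n-1)}R(g)$, where $\Delta_gu=-|g|^{-1/2}\partial_a(|g|^{1/2}g^{ab}\partial_bu)$, $|g|=\det(g_{ab})$, and $R(g)$ is the scalar curvature. Functions $f,f^k$ are understood to be $C^2$. Conformal harmonic coordinates on $\Omega$: coordinates $(Z^1,\ldots,Z^n)$ on $\Omega$ such that $Z^k=f^k/f$, $k=1,\ldots,n$, for some functions $f^k$ and $f>0$ on $\Omega$ with $L_gf^k=L_gf=0$ on $\Omega$. If $\Omega$ meets $\partial M$, coordinates near boundary points are boundary coordinate systems, i.e. they map into $\{x^n\geq 0\}$ and map $\Omega\cap\partial M$ into $\{x^n=0\}$. If $g$ is $C^r$, the atlas has $C^{r+1}$ transition functions and $g$ is $C^r$ up to the boundary. *)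

(* Defs.v *)
From HB Require Import structures.
From mathcomp Require Import all_boot all_order all_algebra.
From mathcomp Require Import all_classical all_reals all_analysis.

Set Implicit Arguments.
Unset Strict Implicit.
Unset Printing Implicit Defensive.

Import Order.TTheory GRing.Theory Num.Theory.
Import numFieldNormedType.Exports.

Local Open Scope classical_set_scope.
Local Open Scope ring_scope.

Section Calculus.
Context {R : realType} {n : nat}.
Implicit Types (V : set 'rV[R]_n) (u : 'rV[R]_n -> R) (y : 'rV[R]_n).

(* V is, near each of its points, either open in R^n or equal to the closed
   half-space {x^n >= 0} with the point on {x^n = 0}. These are the possible
   ranges of coordinates on an open subset of a manifold with boundary. *)
Definition half_space_domain V : Prop :=
  forall y, V y ->
    nbhs y V \/
    exists i : 'I_n, [/\ i.+1 = n, y 0 i = 0 &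
      \forall z \near y, V z <-> 0 <= z 0 i].

(* The increment h is restricted to y + h e_a in V, so that the derivative is
   one-sided where V ends, and the usual partial derivative inside V. *)
Definition diff_quot V (a : 'I_n) u y : set_system R :=
  (fun h : R => h^-1 * (u (y + h *: delta_mx 0 a) - u y)) @
    within [set h | V (y + h *: delta_mx 0 a)] 0^'.

Definition pd_exists V a u y : Prop := cvg (diff_quot V a u y).

Definition pd V a u y : R := lim (diff_quot V a u y).

Definition iter_pd V (s : seq 'I_n) u : 'rV[R]_n -> R := foldr (pd V) u s.

Definition Ck V (k : nat) u : Prop :=
  forall s : seq 'I_n, (size s <= k)%N ->
    {within V, continuous (iter_pd V s u)} /\
    ((size s < k)%N ->
      forall a y, V y -> pd_exists V a (iter_pd V s u) y).

Definition locally_hoelder V (alpha : R) u : Prop :=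
  forall y, V y -> exists (U : set 'rV[R]_n) (C : R), nbhs y U /\
    forall x z, V x -> V z -> U x -> U z -> `|u x - u z| <= C * `|x - z| `^ alpha.

(* C^r for real r >= 0 is C^(k, r - k) with k the integer part of r. If r = k
   the Hoelder condition is local boundedness, since t `^ 0 = 1, and the class
   is the usual C^k. *)
Definition Creal V (r : R) u : Prop :=
  let k := Num.truncn r in
  Ck V k u /\
  forall s : seq 'I_n, size s = k -> locally_hoelder V (r - k%:R) (iter_pd V s u).

End Calculus.

Section LocalGeometry.
Context {R : realType} {n : nat}.
Variables (V : set 'rV[R]_n) (G : 'rV[R]_n -> 'M[R]_n).
Implicit Types (u : 'rV[R]_n -> R) (y : 'rV[R]_n) (a b c d : 'I_n).

Definition ginv y : 'M[R]_n := invmx (G y).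

Definition sqrt_det y : R := Num.sqrt (\det (G y)).

(* christoffel c a b is Gamma_{ab}^c *)
Definition christoffel c a b y : R :=
  2^-1 * \sum_d ginv y c d *
    (pd V a (fun z => G z b d) y + pd V b (fun z => G z a d) y
     - pd V d (fun z => G z a b) y).

Definition contracted_christoffel_up a y : R :=
  \sum_b \sum_c ginv y b c * christoffel a b c y.

Definition contracted_christoffel a y : R :=
  \sum_b G y a b * contracted_christoffel_up b y.

Definition ricci a b y : R :=
  \sum_c (pd V c (christoffel c a b) y - pd V b (christoffel c a c) y) +
  \sum_c \sum_d (christoffel c c d y * christoffel d a b y
                 - christoffel c b d y * christoffel d a c y).

(* Normalised so that round spheres have positive scalar curvature. *)
Definition scalar_curvature y : R :=
  \sum_a \sum_b ginv y a b * ricci a b y.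

Definition laplacian u y : R :=
  - (sqrt_det y)^-1 *
    \sum_a pd V a (fun z => sqrt_det z * \sum_b ginv z a b * pd V b u z) y.

Definition conformal_laplacian u y : R :=
  laplacian u y +
  (n%:R - 2) / (4 * (n%:R - 1)) * scalar_curvature y * u y.

End LocalGeometry.

Section Manifold.
Context {R : realType}.

(* cmap is meaningful on cdom only, and cinv on the range of the chart only. *)
Record chart (n : nat) (M : topologicalType) := Chart {
  cdom : set M;
  cmap : M -> 'rV[R]_n;
  cinv : 'rV[R]_n -> M;
  cdom_open : open cdom;
  cmapK : forall p, cdom p -> cinv (cmap p) = p;
  crange_half_space : half_space_domain (cmap @` cdom);
  cmap_continuous : {within cdom, continuous cmap};
  cinv_continuous : {within cmap @` cdom, continuous cinv} }.

Definition range_on n M (phi : chart n M) (A : set M) : set 'rV[R]_n :=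
  cmap phi @` (cdom phi `&` A).

Definition transition n M (phi psi : chart n M) (i : 'I_n) (y : 'rV[R]_n) : R :=
  cmap psi (cinv phi y) 0 i.

Definition compatible n M (s : R) (phi psi : chart n M) : Prop :=
  forall i, Creal (range_on phi (cdom psi)) s (transition phi psi i) /\
            Creal (range_on psi (cdom phi)) s (transition psi phi i).

(* Manifold with possibly empty boundary and maximal C^s atlas; the boundary
   consists of the points that charts send to non-interior points of their
   range. *)
Record manifold (n : nat) (s : R) (M : topologicalType) := Manifold {
  atlas : set (chart n M);
  hausdorffM : hausdorff_space M;
  second_countableM : @second_countable M;
  atlas_cover : forall p, exists2 phi, atlas phi & cdom phi p;
  atlas_compatible : forall phi psi, atlas phi -> atlas psi ->
    compatible s phi psi;
  atlas_maximal : forall phi,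
    (forall psi, atlas psi -> compatible s phi psi) -> atlas phi }.

(* A Riemannian metric of class C^r, given as a covariant 2-tensor field by its
   components in all charts. *)
Record metric (n : nat) (r : R) (M : topologicalType)
    (X : manifold n (r + 1) M) := Metric {
  comp : chart n M -> 'rV[R]_n -> 'M[R]_n;
  comp_Cr : forall phi, atlas X phi -> forall a b,
    Creal (range_on phi setT) r (fun y => comp phi y a b);
  comp_sym : forall phi, atlas X phi -> forall y, range_on phi setT y ->
    (comp phi y)^T = comp phi y;
  comp_pos : forall phi, atlas X phi -> forall y, range_on phi setT y ->
    forall v : 'rV[R]_n, v != 0 -> 0 < (v *m comp phi y *m v^T) 0 0;
  comp_transform : forall phi psi, atlas X phi -> atlas X psi ->
    forall y, range_on phi (cdom psi) y -> forall a b,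
    comp phi y a b =
      \sum_i \sum_j
        pd (range_on phi (cdom psi)) a (transition phi psi i) y *
        pd (range_on phi (cdom psi)) b (transition phi psi j) y *
        comp psi (cmap psi (cinv phi y)) i j }.

Section Functions.
Context {n : nat} {r : R} {M : topologicalType} {X : manifold n (r + 1) M}.
Variable g : metric X.
Implicit Types (Omega : set M) (u : M -> R) (phi Z : chart n M).

Definition C2_on Omega u : Prop :=
  forall phi, atlas X phi -> Ck (range_on phi Omega) 2 (u \o cinv phi).

(* The value at p of L_g u, computed in the coordinates phi. *)
Definition Lg phi Omega u (p : M) : R :=
  conformal_laplacian (range_on phi Omega) (comp g phi) (u \o cinv phi)
    (cmap phi p).

(* Vanishing is required in all coordinates, so that the definition does not
   rest on the coordinate invariance of L_g. *)
Definition Lg_zero_on Omega u : Prop :=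
  forall phi, atlas X phi ->
  forall p, Omega p -> cdom phi p -> Lg phi Omega u p = 0.

Definition coordinates_on Omega Z : Prop := atlas X Z /\ cdom Z = Omega.

Definition conformal_harmonic Omega Z : Prop :=
  exists (f : M -> R) (F : 'I_n -> M -> R),
    [/\ C2_on Omega f, forall k, C2_on Omega (F k),
        forall p, Omega p -> 0 < f p,
        Lg_zero_on Omega f /\ (forall k, Lg_zero_on Omega (F k)) &
        forall k p, Omega p -> cmap Z p 0 k = F k p / f p].

Definition Gamma_low Z a (p : M) : R :=
  contracted_christoffel (range_on Z setT) (comp g Z) a (cmap Z p).

(* Coordinate derivative of a function on the domain of Z. *)
Definition coord_pd Z a u (p : M) : R :=
  pd (range_on Z setT) a (u \o cinv Z) (cmap Z p).

End Functions.
End Manifold.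

(* Main.v *)
Require Import Defs.
From HB Require Import structures.
From mathcomp Require Import all_boot all_order all_algebra.
From mathcomp Require Import all_classical all_reals all_analysis.
From mathcomp Require Import perm ring lra.
Set Implicit Arguments.
Unset Strict Implicit.
Unset Printing Implicit Defensive.
Import Order.TTheory GRing.Theory Num.Theory.
Import numFieldNormedType.Exports.
Local Open Scope classical_set_scope.
Local Open Scope ring_scope.

(** The heart of the matter is the product rule
      L (u f) = u (L f) + f (Delta u) - 2 <du, df>,
    [conformal_laplacianM], together with the fact that the Laplacian of the
    coordinate Z^k is the contracted Christoffel symbol Gamma^k of the metric in
    the coordinates Z.  Thus, when L f = 0,
      L (Z^k f) = f Gamma^k - 2 g^kb d_b f,
    and all functions F^k = Z^k f are annihilated by L if and only if
    f Gamma^k = 2 g^kb d_b f for all k.  Lowering the index and dividing by f,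
    this is Gamma_a = 2 d_a log f ([Gamma_low_log]).

    If Z is conformal harmonic, it suffices to read the equations in the chart Z
    ([conformal_laplacian_coordM]).  In the other direction, F^k = Z^k f has to
    be annihilated by L in every chart phi.  As L f = 0 is known in all charts,
    the product rule reduces this to the transformation of Delta Z^k and of
    <dZ^k, df> from phi to Z ([laplacian_transition], [gradient_transition]).

    The Laplacian is brought into the non-divergence form
      Delta u = - g^ab d_a d_b u + Gamma^k d_k u
    ([laplacianE]) by means of the derivatives of the determinant and of the
    inverse of the metric, and the transformation of Gamma^k is matrix algebra
    ([christoffel_trace_transform]).  The change of charts also needs the chain
    rule ([is_pd_chain]) and the symmetry of second derivatives ([pdC]) for
    partial derivatives that are one-sided at the boundary.  Both rest on the
    mean value theorem along coordinate segments: near each of its points, the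
    domain contains the boxes that these arguments need ([corner_domain]). *)

(** * Partial derivatives relative to a domain *)

Section PartialDerivatives.
Context {R : realType} {n : nat}.
Implicit Types (V : set 'rV[R]_n) (u v : 'rV[R]_n -> R) (y : 'rV[R]_n).

Definition steps V (a : 'I_n) y : set_system R :=
  within [set h | V (y + h *: delta_mx 0 a)] 0^'.

Definition is_pd V (a : 'I_n) u y (l : R) : Prop := diff_quot V a u y --> l.

(** A local shape shared by open sets and half-spaces, and all that the calculus
    below uses of them.  With x := z it puts into V the box spanned by y and a
    nearby point z of V, so that one can walk from y to z along coordinate
    directions; with x := y it puts into V the part near y of the positive
    orthant at y, so that one-sided difference quotients at y are never vacuous. *)
Definition corner_domain V : Prop := forall y, V y ->
  exists2 e : R, 0 < e & forall x w : 'rV[R]_n, V x ->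
    (forall j, `|y 0 j - x 0 j| < e) -> (forall j, `|y 0 j - w 0 j| < e) ->
    (forall j, Num.min (x 0 j) (y 0 j) <= w 0 j) -> V w.

Lemma nbhs_rowP y (P : set 'rV[R]_n) :
  nbhs y P <-> exists2 e : R, 0 < e &
    forall z : 'rV[R]_n, (forall j, `|y 0 j - z 0 j| < e) -> P z.
Proof.
split.
  move=> /nbhs_ballP[e /= e0 H]; exists e => // z hz; apply: H.
  by split => // i j; rewrite (ord1 i); apply: hz.
move=> [e e0 H]; apply/nbhs_ballP; exists e => //= z [_ hz]; apply: H => j.
exact: hz.
Qed.

Lemma half_space_corner V : half_space_domain V -> corner_domain V.
Proof.
move=> HV y Vy; case: (HV y Vy) => [/nbhs_rowP[e e0 He]|].
  by exists e => // x w _ _ hw _; apply: He.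
move=> [i [_ yi0 /nbhs_rowP[e e0 He]]]; exists e => // x w Vx hx hw hm.
apply/(He _ hw); apply: le_trans (hm i); rewrite yi0 le_min lexx andbT.
exact/(He _ hx).
Qed.

Lemma step_coord y (h : R) (a j : 'I_n) :
  (y + h *: delta_mx 0 a) 0 j = y 0 j + h *+ (j == a).
Proof. by rewrite !mxE eqxx /= mulr_natr. Qed.

Lemma corner_step V y (a : 'I_n) : corner_domain V -> V y ->
  exists2 e : R, 0 < e & forall h, 0 <= h < e -> V (y + h *: delta_mx 0 a).
Proof.
move=> cV Vy; have [e e0 He] := cV y Vy; exists e => // h /andP[h0 he].
apply: (He y) => // j; first by rewrite subrr normr0.
  rewrite step_coord opprD addrA subrr add0r normrN.
  by case: eqP => _; rewrite ?mulr0n ?normr0// mulr1n ger0_norm.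
by rewrite minxx step_coord lerDl; case: eqP.
Qed.

(** Limits of difference quotients are unique because arbitrarily small positive
    steps are admissible. *)
Lemma corner_steps_proper V y (a : 'I_n) : corner_domain V -> V y ->
  ProperFilter (steps V a y).
Proof.
move=> cV Vy; have [e e0 He] := corner_step a cV Vy.
apply: Build_ProperFilter_ex => P.
rewrite /steps /within /= /dnbhs /within /= => /nbhs_ballP[d /= d0 Hd].
pose h := Num.min d e / 2.
have me0 : 0 < Num.min d e by rewrite lt_min d0.
have h0 : 0 < h by rewrite divr_gt0.
have hm : h < Num.min d e by rewrite /h; lra.
exists h; apply: Hd => /=.
- rewrite /ball /= sub0r normrN gtr0_norm//.
  by apply: lt_le_trans hm _; rewrite ge_min lexx.
- by rewrite gt_eqF.
- apply: He; rewrite ltW//=; apply: lt_le_trans hm _.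
  by rewrite ge_min lexx orbT.
Qed.

Section AtPoint.
Variables (V : set 'rV[R]_n) (y : 'rV[R]_n).
Variable a : 'I_n.

Let F := steps V a y.

Lemma is_pd_pd u l : corner_domain V -> V y -> is_pd V a u y l -> pd V a u y = l.
Proof.
move=> cV Vy H; have := corner_steps_proper a cV Vy => FF.
by apply: (cvg_lim _ H).
Qed.

Lemma pd_existsP u : pd_exists V a u y -> is_pd V a u y (pd V a u y).
Proof. by []. Qed.

Lemma is_pd_exists u l : is_pd V a u y l -> pd_exists V a u y.
Proof. by move=> H; apply/cvg_ex; exists l. Qed.

Lemma steps_in : \forall h \near F, V (y + h *: delta_mx 0 a).
Proof. by apply: withinT; apply: nbhs_filter. Qed.

Lemma steps_neq0 : \forall h \near F, h != 0.
Proof. by apply: cvg_within; apply: withinT; apply: nbhs_filter. Qed.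

Lemma is_pd_ext u v l : V y -> {in V, u =1 v} -> is_pd V a u y l -> is_pd V a v y l.
Proof.
move=> Vy uv; apply: cvg_trans; apply: near_eq_cvg.
near=> h; rewrite !uv// inE//; near: h; exact: steps_in.
Unshelve. all: by end_near. Qed.

Lemma is_pd_cst c : is_pd V a (fun=> c) y 0.
Proof.
rewrite /is_pd /diff_quot; under eq_fun do rewrite subrr mulr0.
exact: cvg_cst.
Qed.

Lemma is_pdD u v l m : is_pd V a u y l -> is_pd V a v y m ->
  is_pd V a (fun z => u z + v z) y (l + m).
Proof.
move=> hu hv; rewrite /is_pd /diff_quot.
under eq_fun do rewrite opprD addrACA mulrDr.
exact: cvgD.
Qed.

Lemma is_pd_step u l : is_pd V a u y l ->
  u (y + h *: delta_mx 0 a) @[h --> F] --> u y.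
Proof.
move=> hu; rewrite -[X in _ --> X]addr0 -(mul0r l).
apply: (@cvg_trans _ ((u y + h * (h^-1 * (u (y + h *: delta_mx 0 a) - u y))) @[h --> F])).
  apply: near_eq_cvg; near=> h => /=; rewrite mulrA mulfV ?mul1r; first by rewrite addrC subrK.
  by near: h; exact: steps_neq0.
apply: cvgD; first exact: cvg_cst.
apply: cvgM => //.
apply: cvg_trans; last exact: cvg_id.
by apply: cvg_trans; [apply: cvg_within|apply: cvg_within].
Unshelve. all: by end_near. Qed.

Lemma is_pdM u v l m : is_pd V a u y l -> is_pd V a v y m ->
  is_pd V a (fun z => u z * v z) y (l * v y + u y * m).
Proof.
move=> hu hv; rewrite /is_pd /diff_quot.
have -> : (fun h => h^-1 * (u (y + h *: delta_mx 0 a) * v (y + h *: delta_mx 0 a) - u y * v y)) =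
  (fun h => h^-1 * (u (y + h *: delta_mx 0 a) - u y) * v (y + h *: delta_mx 0 a)
          + u y * (h^-1 * (v (y + h *: delta_mx 0 a) - v y))).
  by apply/funext => h; ring.
apply: cvgD; first by apply: cvgM => //; exact: (is_pd_step hv).
by apply: cvgM => //; exact: cvg_cst.
Qed.

Lemma is_pd_coord j : is_pd V a (fun z => z 0 j) y (a == j)%:R.
Proof.
rewrite /is_pd /diff_quot.
apply: (@cvg_trans _ ((fun=> (a == j)%:R) @ F)); last exact: cvg_cst.
apply: near_eq_cvg; near=> h; rewrite step_coord addrAC subrr add0r.
rewrite (eq_sym a) -[h *+ _]mulr_natr mulrA mulVf ?mul1r//.
by near: h; exact: steps_neq0.
Unshelve. all: by end_near. Qed.

Lemma is_pd_sum (I : Type) (s : seq I) (w : I -> 'rV[R]_n -> R) (m : I -> R) :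
  (forall i, is_pd V a (w i) y (m i)) ->
  is_pd V a (fun z => \sum_(i <- s) w i z) y (\sum_(i <- s) m i).
Proof.
move=> H; elim: s => [|i s IH].
  under eq_fun do rewrite big_nil; rewrite big_nil; exact: is_pd_cst.
by under eq_fun do rewrite big_cons; rewrite big_cons; exact: is_pdD.
Qed.

Lemma is_pd_prod (I : eqType) (s : seq I) (w : I -> 'rV[R]_n -> R) (m : I -> R) :
  uniq s -> (forall i, is_pd V a (w i) y (m i)) ->
  is_pd V a (fun z => \prod_(i <- s) w i z) y
    (\sum_(i <- s) m i * \prod_(j <- s | j != i) w j y).
Proof.
move=> us H; elim: s us => [_|i s IH /= /andP[nis us]].
  under eq_fun do rewrite big_nil; rewrite big_nil; exact: is_pd_cst.
under eq_fun do rewrite big_cons; rewrite !big_cons.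
have := is_pdM (H i) (IH us); congr (is_pd _ _ _ _ _); congr (_ + _).
  rewrite eqxx /=; congr (_ * _); rewrite big_seq [RHS]big_seq_cond.
  apply: eq_bigl => j; case: eqP => [->|]; rewrite ?andbT ?andbF //=.
  exact: negbTE.
rewrite big_distrr /= [LHS]big_seq [RHS]big_seq; apply: eq_bigr => j js.
rewrite big_cons ifT; first by rewrite mulrCA.
by apply: contraNneq nis => ->.
Qed.

(** The slope function q of w at u y, completed by m at u y itself, is continuous
    there; this avoids dividing by an increment of u that may vanish. *)
Lemma is_pd_comp (w : R -> R) u l (m : R) : is_derive (u y) 1 w m ->
  is_pd V a u y l -> is_pd V a (fun z => w (u z)) y (m * l).
Proof.
move=> dw hu; have [wd wm] := dw.
pose q (t : R) := if t == u y then m else (t - u y)^-1 * (w t - w (u y)).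
have qE t : w t - w (u y) = q t * (t - u y).
  rewrite /q; case: eqP => [->|/eqP ne]; first by rewrite !subrr mulr0.
  by rewrite mulrAC mulVf ?mul1r// subr_eq0.
have qm : q t @[t --> u y] --> q (u y).
  apply/continuous_withinNx; rewrite {2}/q eqxx.
  have := wd; rewrite /derivable => /cvg_ex[m' hm'].
  have m'E : m' = m by rewrite -wm; apply/esym/cvg_lim.
  rewrite m'E in hm'.
  apply: (@cvg_trans _ ((fun t => (t - u y)^-1 *: (w (t - u y + u y) - w (u y))) @ (u y)^')).
    apply: near_eq_cvg; near=> t; rewrite subrK /q ifF//.
    by apply/negbTE; near: t; exact: nbhs_dnbhs_neq.
  have sh : (t - u y) @[t --> (u y)^'] --> 0^'.
    move=> P; rewrite /dnbhs /within /= => /nbhs_ballP[e e0 He].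
    apply/nbhs_ballP; exists e => // t tb tn /=; apply: He => /=.
      by move: tb; rewrite /ball/= sub0r opprB.
    by rewrite subr_eq0.
  apply: cvg_trans; last exact: (cvg_comp _ _ sh hm'); apply: near_eq_cvg.
  by near=> t => /=; rewrite [_ *: 1]mulr1.
rewrite /is_pd /diff_quot.
under eq_fun do rewrite qE mulrCA.
apply: cvgM => //.
have -> : m = q (u y) by rewrite /q eqxx.
exact: (cvg_comp _ _ (is_pd_step hu) qm).
Unshelve. all: by end_near. Qed.

End AtPoint.
End PartialDerivatives.

Arguments is_pd_coord {R n} V y a j.
Arguments is_pd_cst {R n} V y a c.

(** * Functions of class C^k on a domain with boundary *)

Section Smoothness.
Context {R : realType} {n : nat}.
Implicit Types (V : set 'rV[R]_n) (u v : 'rV[R]_n -> R) (y : 'rV[R]_n).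

Lemma Ck_continuous V k u : Ck V k u -> {within V, continuous u}.
Proof. by move=> /(_ [::])[]. Qed.

Lemma Ck_pd_exists V k u a y : Ck V k.+1 u -> V y -> pd_exists V a u y.
Proof. by move=> /(_ [::])[] // _ + Vy; apply. Qed.

Lemma Ck_pd V k u a : Ck V k.+1 u -> Ck V k (pd V a u).
Proof.
move=> H s ss; have := H (rcons s a); rewrite size_rcons ltnS => /(_ ss).
by rewrite /iter_pd foldr_rcons.
Qed.

Arguments Ck_pd_exists [V k u] a [y] _ _.
Arguments Ck_pd [V k u] a _.

Lemma CkS V k u : {within V, continuous u} ->
  (forall a y, V y -> pd_exists V a u y) -> (forall a, Ck V k (pd V a u)) ->
  Ck V k.+1 u.
Proof.
move=> uc ue up s; case/lastP: s => [|s a]; first by move=> _; split.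
by rewrite size_rcons !ltnS /iter_pd foldr_rcons; apply: up.
Qed.

Lemma Ck_leq V k m u : (k <= m)%N -> Ck V m u -> Ck V k u.
Proof.
move=> km H s sk; have [H1 H2] := H s (leq_trans sk km).
by split => // sk'; apply: H2; apply: leq_trans km.
Qed.

Lemma Ck0 V u : {within V, continuous u} -> Ck V 0 u.
Proof. by move=> uc [|//]. Qed.

Lemma within_nearP V u y (P : set R) : {within V, continuous u} -> V y ->
  nbhs (u y) P -> exists2 e : R, 0 < e &
    forall z : 'rV[R]_n, V z -> (forall j, `|y 0 j - z 0 j| < e) -> P (u z).
Proof.
move=> /subspace_continuousP uc Vy Pu.
have /nbhs_rowP[e e0 He] := uc y Vy P Pu.
by exists e => // z Vz zy; apply: He.
Qed.

(** Apart from the end points, a coordinate segment in V is approached from both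
    sides inside V, so that the one-sided definition gives honest derivatives
    and the mean value theorem applies, even on the boundary of V. *)
Lemma pd_mean_value V u (du : 'rV[R]_n -> R) (a : 'I_n) (x : 'rV[R]_n) (s : R) :
  {within V, continuous u} -> (forall y, V y -> is_pd V a u y (du y)) ->
  (forall t : R, 0 <= t <= 1 -> V (x + (t * s) *: delta_mx 0 a)) ->
  exists2 t : R, 0 <= t <= 1 &
    u (x + s *: delta_mx 0 a) - u x = du (x + (t * s) *: delta_mx 0 a) * s.
Proof.
move=> uc ue HV.
have [->|s0] := eqVneq s 0.
  by exists 0; rewrite ?lexx ?ler01// scale0r addr0 subrr mulr0.
pose P (t : R) := x + (t * s) *: delta_mx 0 a.
have PD (t h : R) : P (t + h) = P t + (h * s) *: delta_mx 0 a.
  by rewrite /P mulrDl scalerDl addrA.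
pose w (t : R) := u (P t).
have wc : {within `[0, 1], continuous w}.
  apply/subspace_continuousP => t /= t01 Q wQ.
  rewrite in_itv/= in t01.
  have [e e0 He] := within_nearP uc (HV t t01) wQ.
  apply/nbhs_ballP; exists (e / `|s|) => /=; first by rewrite divr_gt0// normr_gt0.
  move=> r /= tr; rewrite in_itv/= => r01; apply: He; first exact: HV.
  move=> j; rewrite !step_coord opprD addrACA subrr add0r -mulrnBl.
  case: (_ == _); rewrite ?mulr0n ?normr0// mulr1n -mulrBl normrM.
  by rewrite -ltr_pdivlMr// normr_gt0.
have wd (t : R) : t \in `]0, 1[ -> is_derive t 1 w (du (P t) * s).
  rewrite in_itv/= => /andP[t0 t1].
  have VP : V (P t) by apply: HV; rewrite !ltW.
  have H : is_pd V a u (P t) (du (P t)) := ue _ VP.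
  have sh : h * s @[h --> 0^'] --> steps V a (P t).
    move=> Q; rewrite /steps /within /= /dnbhs /within /= => /nbhs_ballP[e /= e0 He].
    have t10 : 0 < 1 - t by lra.
    pose d := Num.min (e / `|s|) (Num.min t (1 - t)).
    apply/nbhs_ballP; exists d => /=.
      by rewrite !lt_min t0 t10 divr_gt0// normr_gt0.
    move=> h /=; rewrite /ball /= sub0r normrN !lt_min => /and3P[h1 h2 h3] hn.
    apply: He => /=.
    - by rewrite /ball /= sub0r normrN normrM -ltr_pdivlMr// normr_gt0.
    - by rewrite mulf_neq0.
    - rewrite -PD; apply: HV; move: h2 h3; rewrite !ltr_norml => /andP[? ?] /andP[? ?]; lra.
  have L : h^-1 *: ((w \o shift t) (h *: 1) - w t) @[h --> 0^'] --> du (P t) * s.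
    have M := cvgM (cvg_comp _ _ sh H) (cvg_cst s).
    apply: cvg_trans; last exact: M.
    apply: near_eq_cvg; near=> h => /=.
    have -> : h *: (1 : R) + t = t + h by rewrite addrC; congr (_ + _); exact: mulr1.
    rewrite /w PD.
    have h0 : h != 0 by near: h; exact: nbhs_dnbhs_neq.
    transitivity (h^-1 * (u (P t + (h * s) *: delta_mx 0 a) - u (P t))) => //.
    by field; rewrite h0 s0.
  split; first by apply/cvg_ex; eexists; exact: L.
  exact/cvg_lim.
have [t t01 E] := MVT ltr01 wd wc.
exists t; first by move: t01; rewrite in_itv/= => /andP[? ?]; rewrite !ltW.
by move: E; rewrite /w /P mul0r scale0r addr0 mul1r subr0 mulr1.
Unshelve. all: by end_near. Qed.

Section Corner.
Variable V : set 'rV[R]_n.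
Hypothesis cV : corner_domain V.

Lemma pd_ext a u v y : V y -> {in V, u =1 v} -> pd_exists V a u y ->
  pd V a v y = pd V a u y.
Proof. by move=> Vy uv ue; exact: (is_pd_pd cV Vy (is_pd_ext Vy uv (pd_existsP ue))). Qed.

Lemma Ck_ext k u v : {in V, u =1 v} -> Ck V k u -> Ck V k v.
Proof.
elim: k u v => [|k IH] u v uv hu.
  by apply: Ck0; apply: subspace_eq_continuous (Ck_continuous hu).
apply: CkS => [|a y Vy|a].
- by apply: subspace_eq_continuous (Ck_continuous hu).
- exact: (is_pd_exists (is_pd_ext Vy uv (pd_existsP (Ck_pd_exists a hu Vy)))).
- apply: IH (Ck_pd a hu) => y; rewrite inE => Vy; apply/esym.
  exact: pd_ext Vy uv (Ck_pd_exists a hu Vy).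
Qed.

Arguments pd_ext a [u v y] _ _ _.

Lemma CkD k u v : Ck V k u -> Ck V k v -> Ck V k (fun z => u z + v z).
Proof.
elim: k u v => [|k IH] u v hu hv.
  by apply: Ck0 => x; apply: cvgD; [apply: (Ck_continuous hu)|apply: (Ck_continuous hv)].
have pduv a y : V y -> is_pd V a (fun z => u z + v z) y (pd V a u y + pd V a v y).
  by move=> Vy; apply: is_pdD; [apply: (Ck_pd_exists a hu)|apply: (Ck_pd_exists a hv)].
apply: CkS => [x|a y Vy|a].
- by apply: cvgD; [apply: (Ck_continuous hu)|apply: (Ck_continuous hv)].
- exact: is_pd_exists (pduv a y Vy).
- apply: Ck_ext (IH _ _ (Ck_pd a hu) (Ck_pd a hv)) => y; rewrite inE => Vy.
  by apply/esym; exact: (is_pd_pd cV Vy (pduv a y Vy)).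
Qed.

Lemma CkM k u v : Ck V k u -> Ck V k v -> Ck V k (fun z => u z * v z).
Proof.
elim: k u v => [|k IH] u v hu hv.
  by apply: Ck0 => x; apply: cvgM; [apply: (Ck_continuous hu)|apply: (Ck_continuous hv)].
have pduv a y : V y -> is_pd V a (fun z => u z * v z) y (pd V a u y * v y + u y * pd V a v y).
  by move=> Vy; exact: is_pdM (pd_existsP (Ck_pd_exists a hu Vy)) (pd_existsP (Ck_pd_exists a hv Vy)).
apply: CkS => [x|a y Vy|a].
- by apply: cvgM; [apply: (Ck_continuous hu)|apply: (Ck_continuous hv)].
- exact: is_pd_exists (pduv a y Vy).
- apply: Ck_ext (CkD (IH _ _ (Ck_pd a hu) (Ck_leq (leqnSn k) hv))
                     (IH _ _ (Ck_leq (leqnSn k) hu) (Ck_pd a hv))) => y.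
  by rewrite inE => Vy; apply/esym; apply: is_pd_pd (pduv a y Vy).
Qed.

(** A C^1 function on a corner domain is differentiable, in the form of
    Caratheodory: u z - u y = sum_j phi_j z * (z_j - y_j) with phi_j continuous
    at y.  One changes the coordinates of y into those of z one at a time and
    applies the mean value theorem on each leg; phi_j z is the partial
    derivative at the intermediate point on the j-th leg. *)
Lemma Ck_caratheodory u y : Ck V 1 u -> V y ->
  exists phi : 'I_n -> 'rV[R]_n -> R,
    (forall j, phi j z @[z --> within V (nbhs y)] --> pd V j u y) /\
    (\forall z \near within V (nbhs y),
       u z - u y = \sum_j phi j z * (z 0 j - y 0 j)).
Proof.
move=> hu Vy; have [e e0 He] := cV Vy.
(* the k-th corner of the path from y to z *)
pose p (z : 'rV[R]_n) (k : nat) : 'rV[R]_n := \row_j (if (j < k)%N then z 0 j else y 0 j).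
pose near_y (z : 'rV[R]_n) := V z /\ forall j, `|y 0 j - z 0 j| < e.
have leg (kz : 'I_n * 'rV[R]_n) : exists xi : 'rV[R]_n, near_y kz.2 ->
    [/\ V xi, forall j, `|y 0 j - xi 0 j| <= `|y 0 j - kz.2 0 j| &
    u (p kz.2 kz.1.+1) - u (p kz.2 kz.1) = pd V kz.1 u xi * (kz.2 0 kz.1 - y 0 kz.1)].
  case: kz => k z /=; have [nz|] := pselect (near_y z); last by exists y.
  case: (nz) => Vz zy.
  have xiE (t : R) j : (p z k + (t * (z 0 k - y 0 k)) *: delta_mx 0 k) 0 j =
     if (j < k)%N then z 0 j else if j == k then y 0 j + t * (z 0 j - y 0 j) else y 0 j.
    rewrite step_coord mxE; case: (eqVneq j k) => [->|jk]; first by rewrite ltnn.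
    by rewrite addr0.
  have xin (t : R) j : 0 <= t <= 1 ->
    `|y 0 j - (p z k + (t * (z 0 k - y 0 k)) *: delta_mx 0 k) 0 j| <= `|y 0 j - z 0 j|.
    move=> /andP[t0 t1]; rewrite xiE; case: ifP => // _.
    case: ifP => _; last by rewrite subrr normr0.
    rewrite opprD addrA subrr add0r -mulrN opprB normrM ger0_norm//.
    by rewrite ler_piMl.
  have xiV (t : R) : 0 <= t <= 1 -> V (p z k + (t * (z 0 k - y 0 k)) *: delta_mx 0 k).
    move=> t01; apply: (He z) => // j; first exact: le_lt_trans (xin t j t01) (zy j).
    rewrite xiE; case: ifP => _; first by rewrite ge_min lexx.
    case: ifP => _; last by rewrite ge_min lexx orbT.
    case/andP: t01 => t0 t1; rewrite ge_min.
    by case: (leP (z 0 j) (y 0 j)) => h; apply/orP; [left|right]; nra.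
  have [t t01 E] := @pd_mean_value V u (pd V k u) k _ _ (Ck_continuous hu)
    (fun w Vw => pd_existsP (Ck_pd_exists k hu Vw)) xiV.
  exists (p z k + (t * (z 0 k - y 0 k)) *: delta_mx 0 k) => _; split.
  - exact: xiV.
  - by move=> j; apply: xin.
  - rewrite -E; congr (u _ - _); apply/rowP => j.
    rewrite -[_ - y 0 k]mul1r xiE mxE ltnS leq_eqVlt -val_eqE /=.
    by case: ltngtP => //= _; ring.
have [xi Hxi] := choice leg.
exists (fun k z => pd V k u (xi (k, z))); split.
  move=> j P Pj; have [d d0 Hd] := within_nearP (Ck_continuous (Ck_pd j hu)) Vy Pj.
  apply/nbhs_rowP; exists (Num.min d e); first by rewrite lt_min d0.
  move=> z zy Vz.
  have nz : near_y z by split => // i; move: (zy i); rewrite lt_min => /andP[].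
  have [/= Vxi xin _] := Hxi (j, z) nz; apply: Hd => // i.
  by apply: le_lt_trans (xin i) _; move: (zy i); rewrite lt_min => /andP[].
apply/nbhs_rowP; exists e => // z zy Vz.
have -> : u z - u y = \sum_(0 <= k < n) (u (p z k.+1) - u (p z k)).
  rewrite telescope_sumr//; congr (u _ - u _); apply/rowP => j; rewrite mxE //.
  by rewrite ltn_ord.
rewrite big_mkord; apply: eq_bigr => k _.
by have [] := Hxi (k, z) (conj Vz zy).
Qed.

(** The second difference of u over a small square with corner y equals h * h
    times either mixed derivative at some point of the square.  The square is
    taken in the positive directions, so that it lies in V also when y is a
    boundary point. *)
Lemma pdC u (a b : 'I_n) y : Ck V 2 u -> V y ->
  pd V a (pd V b u) y = pd V b (pd V a u) y.
Proof.
have [<-//|ab] := eqVneq a b.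
move=> hu Vy; have [e e0 He] := cV Vy.
have key (c d : 'I_n) (h : R) : c != d -> 0 < h < e ->
    exists z : 'rV[R]_n, [/\ V z, forall j, `|y 0 j - z 0 j| <= h &
      u (y + h *: delta_mx 0 d + h *: delta_mx 0 c) - u (y + h *: delta_mx 0 c)
      - (u (y + h *: delta_mx 0 d) - u y) = pd V d (pd V c u) z * h * h].
  move=> cd /andP[h0 he].
  have coordE (s t : R) j : (y + s *: delta_mx 0 c + t *: delta_mx 0 d) 0 j =
      y 0 j + (if j == c then s else if j == d then t else 0).
    rewrite !step_coord; have [->|jc] := eqVneq j c.
      by rewrite (negPf cd) addr0.
    by rewrite addr0; case: eqP.
  have sV (s t : R) : 0 <= s <= h -> 0 <= t <= h ->
      V (y + s *: delta_mx 0 c + t *: delta_mx 0 d) /\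
      forall j, `|y 0 j - (y + s *: delta_mx 0 c + t *: delta_mx 0 d) 0 j| <= h.
    move=> /andP[s0 sh] /andP[t0 th].
    have bd j : `|y 0 j - (y + s *: delta_mx 0 c + t *: delta_mx 0 d) 0 j| <= h.
      rewrite coordE opprD addrA subrr add0r normrN ger0_norm.
        by case: ifP => // _; case: ifP => // _; exact: ltW.
      by case: ifP => // _; case: ifP.
    split=> //; apply: (He y) => // j; first by rewrite subrr normr0.
      exact: le_lt_trans (bd j) he.
    rewrite minxx coordE lerDl.
    by case: ifP => // _; case: ifP.
  (* w is only defined where both z and its translate lie in V *)
  pose w z := u (z + h *: delta_mx 0 d) - u z.
  pose V1 : set 'rV[R]_n := [set z | V z /\ V (z + h *: delta_mx 0 d)].
  have h01 (t : R) : 0 <= t <= 1 -> 0 <= t * h <= h.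
    by move=> /andP[t0 t1]; rewrite mulr_ge0 ?(ltW h0)//= ler_piMl// ltW.
  have h0h : 0 <= h <= h by rewrite ltW//= lexx.
  have h00 : 0 <= (0 : R) <= h by rewrite lexx ltW.
  have V1V (t : R) : 0 <= t <= 1 -> V1 (y + (t * h) *: delta_mx 0 c).
    move=> /h01 t01; split; last by have [] := sV _ _ t01 h0h.
    by have [] := sV _ _ t01 h00; rewrite scale0r addr0.
  have w_cont : {within V1, continuous w}.
    apply/subspace_continuousP => x [Vx Vxh].
    apply: cvgB => P Pu.
      have [d0 d00 Hd] := within_nearP (Ck_continuous hu) Vxh Pu.
      apply/nbhs_rowP; exists d0 => // z zx [Vz Vzh]; apply: Hd => // j.
      by rewrite !step_coord opprD addrACA subrr addr0.
    have [d0 d00 Hd] := within_nearP (Ck_continuous hu) Vx Pu.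
    by apply/nbhs_rowP; exists d0 => // z zx [Vz _]; apply: Hd.
  have w_pd z : V1 z -> is_pd V1 c w z (pd V c u (z + h *: delta_mx 0 d) - pd V c u z).
    move=> [Vz Vzh]; rewrite /is_pd /diff_quot.
    have -> : (fun k => k^-1 * (w (z + k *: delta_mx 0 c) - w z)) = (fun k =>
       k^-1 * (u (z + h *: delta_mx 0 d + k *: delta_mx 0 c) - u (z + h *: delta_mx 0 d))
       - k^-1 * (u (z + k *: delta_mx 0 c) - u z)).
      by apply/funext => k; rewrite /w [z + k *: _ + _]addrAC; ring.
    apply: cvgB.
      have := pd_existsP (Ck_pd_exists c hu Vzh).
      apply: cvg_trans; apply: cvg_app; apply: within_subset => k /= [_].
      by rewrite addrAC.
    have := pd_existsP (Ck_pd_exists c hu Vz).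
    by apply: cvg_trans; apply: cvg_app; apply: within_subset => k /= [].
  have [t t01 E] := pd_mean_value w_cont w_pd V1V.
  have hc := Ck_pd c hu.
  have lV (r : R) : 0 <= r <= 1 -> V (y + (t * h) *: delta_mx 0 c + (r * h) *: delta_mx 0 d).
    by move=> /h01 r01; have [] := sV _ _ (h01 _ t01) r01.
  have [r r01 E2] := @pd_mean_value V _ (pd V d (pd V c u)) d _ _ (Ck_continuous hc)
    (fun w Vw => pd_existsP (Ck_pd_exists d hc Vw)) lV.
  exists (y + (t * h) *: delta_mx 0 c + (r * h) *: delta_mx 0 d); split.
  - exact: lV.
  - by have [] := sV _ _ (h01 _ t01) (h01 _ r01).
  - by rewrite -E2 -E /w [y + h *: _ + _]addrAC.
apply/eqP; rewrite -subr_eq0 -normr_le0; apply/ler_addgt0Pl => eps eps0.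
rewrite addr0.
have eps2 : 0 < eps / 2 by lra.
have [d1 d10 H1] := within_nearP (Ck_continuous (Ck_pd a (Ck_pd b hu))) Vy
  (nbhsx_ballx _ _ eps2).
have [d2 d20 H2] := within_nearP (Ck_continuous (Ck_pd b (Ck_pd a hu))) Vy
  (nbhsx_ballx _ _ eps2).
pose m := Num.min e (Num.min d1 d2); pose h := m / 2.
have m0 : 0 < m by rewrite !lt_min e0 d10.
have hm : h < m by rewrite /h; lra.
have h0 : 0 < h by rewrite /h; lra.
have := hm; rewrite !lt_min => /and3P[he hd1 hd2].
have [z1 [Vz1 z1y E1]] := key a b h ab (introT andP (conj h0 he)).
have [z2 [Vz2 z2y E2]] := key b a h (contra_neq esym ab) (introT andP (conj h0 he)).
have E : pd V b (pd V a u) z1 = pd V a (pd V b u) z2.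
  have hn : h != 0 by rewrite gt_eqF.
  move: E1 E2; rewrite [y + h *: delta_mx 0 a + _]addrAC.
  move: (pd V b _ z1) (pd V a _ z2) => p q E1 E2.
  apply: (mulIf hn); apply: (mulIf hn); rewrite -E1 -E2; ring.
have B1 := H2 z1 Vz1 (fun j => le_lt_trans (z1y j) hd2).
have B2 := H1 z2 Vz2 (fun j => le_lt_trans (z2y j) hd1).
move: B1 B2; rewrite /ball /= -E.
move: (pd V b _ z1) (pd V b _ y) (pd V a _ y) => p q s B1 B2.
rewrite [eps]splitr; apply: le_trans (ler_distD p _ _) _.
by apply: lerD; [exact: ltW|rewrite distrC ltW].
Qed.

End Corner.
End Smoothness.

Lemma cvg_sumr {R : realType} {T : Type} (F : set_system T) (FF : Filter F)
    (I : Type) (s : seq I) (f : I -> T -> R) (l : I -> R) :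
  (forall i, f i x @[x --> F] --> l i) ->
  \sum_(i <- s) f i x @[x --> F] --> \sum_(i <- s) l i.
Proof.
move=> H; elim: s => [|i s IH].
  by under eq_fun do rewrite big_nil; rewrite big_nil; exact: cvg_cst.
by under eq_fun do rewrite big_cons; rewrite big_cons; apply: cvgD.
Qed.

Section Chain.
Context {R : realType} {m n : nat}.

(** With the increment of u in Caratheodory form, the difference quotient of the
    composition is a sum of products with convergent factors. *)
Lemma is_pd_chain (V : set 'rV[R]_n) (V' : set 'rV[R]_m)
    (tau : 'rV[R]_n -> 'rV[R]_m) (l : 'I_m -> R) (u : 'rV[R]_m -> R) (a : 'I_n)
    (y : 'rV[R]_n) :
  corner_domain V' -> Ck V' 1 u -> V y -> (forall z, V z -> V' (tau z)) ->
  (forall j, is_pd V a (fun z => tau z 0 j) y (l j)) ->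
  is_pd V a (fun z => u (tau z)) y (\sum_j pd V' j u (tau y) * l j).
Proof.
move=> cV' hu Vy tauV taul.
have [phi [phil uE]] := Ck_caratheodory cV' hu (tauV y Vy).
pose F := steps V a y.
have FF : Filter (nbhs F) by exact: within_filter.
have tauF : tau (y + h *: delta_mx 0 a) @[h --> F] --> within V' (nbhs (tau y)).
  move=> P /nbhs_rowP[e e0 He].
  have ne (j : 'I_m) : \forall h \near F,
      `|tau y 0 j - tau (y + h *: delta_mx 0 a) 0 j| < e.
    have := is_pd_step (taul j) => /(_ (ball (tau y 0 j) e)).
    by apply; exact: nbhsx_ballx.
  have {}ne := filter_forall (FF : Filter F) ne.
  have inV : \forall h \near F, V (y + h *: delta_mx 0 a) by exact: steps_in.
  have Q : \forall h \near F, P (tau (y + h *: delta_mx 0 a)).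
    by apply: filterS2 ne inV => h hne hV; apply: He => //; exact: tauV.
  exact: Q.
have {}uE : \forall h \near F, u (tau (y + h *: delta_mx 0 a)) - u (tau y) =
    \sum_j phi j (tau (y + h *: delta_mx 0 a)) *
      (tau (y + h *: delta_mx 0 a) 0 j - tau y 0 j).
  exact: tauF uE.
rewrite /is_pd /diff_quot.
apply: (@cvg_trans _ ((fun h => \sum_j phi j (tau (y + h *: delta_mx 0 a)) *
   (h^-1 * (tau (y + h *: delta_mx 0 a) 0 j - tau y 0 j))) @ F)).
  apply: near_eq_cvg; near=> h.
  have -> : u (tau (y + h *: delta_mx 0 a)) - u (tau y) =
    \sum_j phi j (tau (y + h *: delta_mx 0 a)) *
      (tau (y + h *: delta_mx 0 a) 0 j - tau y 0 j) by near: h.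
  by rewrite big_distrr; apply: eq_bigr => j _ /=; rewrite mulrCA.
apply: cvg_sumr => j; apply: cvgM; last exact: taul.
exact: (cvg_comp _ _ tauF (phil j)).
Unshelve. all: by end_near. Qed.

End Chain.

Section Ranges.
Context {R : realType} {n : nat} {M : topologicalType}.

(** The inverse chart is continuous, so that near each of its points the range of
    an open set coincides with the full range of the chart. *)
Lemma range_on_half_space (phi : chart (R := R) n M) (A : set M) : open A ->
  half_space_domain (range_on phi A).
Proof.
move=> oA y [p [dp Ap] py].
pose W := cmap phi @` cdom phi.
have Wy : W y by exists p.
have near_range : \forall z \near y, W z -> range_on phi A z.
  have cc : cinv phi z @[z --> within W (nbhs y)] --> cinv phi y.
    by have /subspace_continuousP /(_ y Wy) := @cinv_continuous _ _ _ phi.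
  have nA : nbhs (cinv phi y) A by rewrite -py cmapK//; exact: open_nbhs_nbhs.
  have H : \forall z \near y, W z -> A (cinv phi z) by exact: cc nA.
  apply: filterS H => z WA Wz; have [q dq qz] := Wz.
  by exists q => //; split => //; rewrite -(cmapK dq) qz; exact: WA.
have sub z : range_on phi A z -> W z by move=> [q [dq _] <-]; exists q.
have [nW|[i [ilast yi nW]]] := crange_half_space Wy.
  left; exact: filterS2 near_range nW.
right; exists i; split => //; apply: filterS2 near_range nW => z h1 h2.
by split; [move=> /sub /h2|move=> /h2 /h1].
Qed.

Lemma range_on_corner (phi : chart (R := R) n M) (A : set M) : open A ->
  corner_domain (range_on phi A).
Proof. by move=> oA; apply: half_space_corner; exact: range_on_half_space. Qed.

End Ranges.

Arguments Ck_pd_exists [R n V k u] a [y] _ _.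
Arguments Ck_pd [R n V k u] a _.
Arguments pd_ext [R n V] _ a [u v y] _ _ _.

(** * Positive definite matrices and derivatives of matrix functions *)

Section PositiveDefinite.
Context {R : realType} {n : nat}.

(** The characteristic polynomial of - A is monic, hence positive far to the
    right; at 0 it takes the value det A.  Were that nonpositive, it would have
    a root x >= 0, and an eigenvector v for it would give
    v A v^T = - x |v|^2 <= 0. *)
Lemma posdef_det_gt0 (A : 'M[R]_n) :
  (forall v : 'rV[R]_n, v != 0 -> 0 < (v *m A *m v^T) 0 0) -> 0 < \det A.
Proof.
move=> pA; rewrite ltNge; apply/negP => dA.
pose q := char_poly (- A).
have [b Hb] := monic_Cauchy_bound (char_poly_monic (- A)).
have q0 : q.[0] <= 0.
  by rewrite horner_coef0 char_poly_det -[- A]scaleN1r detZ mulrA -signr_odd -expr2 sqrr_sign mul1r.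
have qb : 0 <= q.[Num.max b 0] by apply/ltW/Hb; rewrite le_max lexx.
have m0 : 0 <= Num.max b 0 by rewrite le_max lexx orbT.
have [x /andP[x0 _]] := poly_ivt m0 (introT andP (conj q0 qb)).
rewrite -eigenvalue_root_char => /eigenvalueP[v vA v0].
have := pA v v0; rewrite -[A]opprK mulmxN vA mulNmx mxE -scalemxAl mxE oppr_gt0.
rewrite ltNge => /negP; apply; apply: mulr_ge0 => //.
by rewrite mxE sumr_ge0// => i _; rewrite mxE -expr2 sqr_ge0.
Qed.

End PositiveDefinite.

Section MatrixDerivatives.
Context {R : realType} {n : nat}.
Variables (V : set 'rV[R]_n) (y : 'rV[R]_n) (a : 'I_n).

(** Jacobi's formula: by the Leibniz expansion, the derivative is the sum over i
    of the determinants with row i differentiated, each of which is expanded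
    along that row. *)
Lemma is_pd_det (m : nat) (A : 'rV[R]_n -> 'M[R]_m) (D : 'M[R]_m) :
  (forall i j, is_pd V a (fun z => A z i j) y (D i j)) ->
  is_pd V a (fun z => \det (A z)) y (\sum_i \sum_j D i j * cofactor (A y) i j).
Proof.
move=> AD.
have : is_pd V a (fun z => \det (A z)) y
   (\sum_(s : 'S_m) (0 * \prod_i A y i (s i) + (-1) ^+ s *
     \sum_i D i (s i) * \prod_(j | j != i) A y j (s j))).
  apply: is_pd_sum => s; apply: is_pdM; first exact: is_pd_cst.
  by apply: is_pd_prod => //; exact: index_enum_uniq.
congr (is_pd _ _ _ _ _).
under eq_bigr do rewrite mul0r add0r big_distrr /=.
rewrite exchange_big; apply: eq_bigr => i _ /=.
pose B := \matrix_(k, j) (if k == i then D i j else A y k j).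
transitivity (\det B).
  apply: eq_bigr => s _; congr (_ * _); rewrite [RHS](bigD1 i)//= !mxE eqxx.
  by congr (_ * _); apply: eq_bigr => j /negPf ji; rewrite mxE ji.
rewrite (expand_det_row B i); apply: eq_bigr => j _; rewrite mxE eqxx; congr (_ * _).
rewrite /cofactor; congr (_ * \det _); apply/matrixP => k l; rewrite !mxE.
by rewrite eq_sym (negPf (neq_lift _ _)).
Qed.

Hypotheses (cV : corner_domain V) (Vy : V y).
Variables (m : nat) (G : 'rV[R]_n -> 'M[R]_m) (D : 'M[R]_m).
Hypothesis GD : forall i j, is_pd V a (fun z => G z i j) y (D i j).

Lemma is_pd_sqrt_det : 0 < \det (G y) ->
  is_pd V a (fun z => Num.sqrt (\det (G z))) y
    (2^-1 * Num.sqrt (\det (G y)) * \tr (invmx (G y) *m D)).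
Proof.
move=> d0; have uG : G y \in unitmx by rewrite unitmxE unitfE gt_eqF.
have := is_pd_comp (is_derive1_sqrt d0) (is_pd_det GD).
congr (is_pd _ _ _ _ _).
have -> : \sum_i \sum_j D i j * cofactor (G y) i j = \det (G y) * \tr (invmx (G y) *m D).
  rewrite /mxtrace big_distrr exchange_big; apply: eq_bigr => i _ /=.
  rewrite mxE big_distrr; apply: eq_bigr => j _ /=.
  rewrite /invmx uG !mxE !mulrA mulfV ?gt_eqF// mul1r -mulrA; exact: mulrC.
rewrite -{2}(sqr_sqrtr (ltW d0)); set s := Num.sqrt _.
have s0 : s != 0 by rewrite gt_eqF// sqrtr_gt0.
by field.
Qed.

(** Cramer's rule shows that the entries of the inverse have derivatives;
    differentiating G *m invmx G = 1 then identifies them. *)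
Lemma is_pd_inv : (forall z, V z -> G z \in unitmx) -> forall i j,
  is_pd V a (fun z => invmx (G z) i j) y (- (invmx (G y) *m D *m invmx (G y)) i j).
Proof.
move=> uG.
have ex i j : pd_exists V a (fun z => invmx (G z) i j) y.
  have dn0 : \det (G y) != 0 by rewrite -unitfE -unitmxE uG.
  have dV := is_pd_comp (is_deriveV dn0 (is_derive_id (\det (G y)) 1)) (is_pd_det GD).
  have dm (k l : 'I_m.-1) :
      is_pd V a (fun z => row' j (col' i (G z)) k l) y (row' j (col' i D) k l).
    by rewrite !mxE; under eq_fun do rewrite !mxE; exact: GD.
  have := is_pdM dV (is_pdM (is_pd_cst V y a ((-1) ^+ (j + i))) (is_pd_det dm)).
  move=> /(is_pd_ext Vy (v := fun z => invmx (G z) i j)) H; apply: is_pd_exists (H _).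
  by move=> z; rewrite inE => Vz; rewrite /invmx uG// !mxE.
pose L : 'M[R]_m := \matrix_(i, j) pd V a (fun z => invmx (G z) i j) y.
have GL : G y *m L = - (D *m invmx (G y)).
  apply/matrixP => i j.
  have H : is_pd V a (fun z => \sum_k G z i k * invmx (G z) k j) y
      (\sum_k (D i k * invmx (G y) k j + G y i k * L k j)).
    apply: is_pd_sum => k; apply: is_pdM => //.
    by rewrite mxE; exact: pd_existsP.
  have H1 : is_pd V a (fun z => \sum_k G z i k * invmx (G z) k j) y 0.
    apply: (is_pd_ext Vy _ (is_pd_cst V y a ((1%:M : 'M[R]_m) i j))) => z.
    by rewrite inE => Vz; rewrite -(mulmxV (uG z Vz)) mxE.
  have := is_pd_pd cV Vy H; rewrite (is_pd_pd cV Vy H1) big_split /= => E.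
  by rewrite !mxE; apply/eqP; rewrite -subr_eq0 opprK addrC -E.
have LE : L = - (invmx (G y) *m D *m invmx (G y)).
  by rewrite -[L](mulKmx (uG y Vy)) GL mulmxN mulmxA.
move=> i j; have := pd_existsP (ex i j).
suff -> : pd V a (fun z => invmx (G z) i j) y =
    - (invmx (G y) *m D *m invmx (G y)) i j by [].
by have /matrixP/(_ i j) := LE; rewrite !mxE.
Qed.

End MatrixDerivatives.

Arguments is_pd_inv [R n V y a] _ _ [m G D] _ _ i j.

(** * The Laplacian and the contracted Christoffel symbols *)

Section ChristoffelTrace.
Context {R : realType} {n : nat}.
Implicit Types (P g J : 'M[R]_n) (E D H : 'I_n -> 'M[R]_n).

(** For P the inverse metric and E the partial derivatives of the metric this is
    the covector P^bc (E_b,cd - E_d,bc / 2), the contracted Christoffel symbols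
    with lowered index. *)
Definition christoffel_trace P E : 'rV[R]_n :=
  \sum_b row b P *m E b - 2^-1 *: \row_d \tr (P *m E d).

Lemma christoffel_traceE P E d : christoffel_trace P E 0 d =
  (\sum_b row b P *m E b) 0 d - 2^-1 * \tr (P *m E d).
Proof. by rewrite !mxE. Qed.

Lemma invmx_congr g J : g \in unitmx -> J \in unitmx ->
  J^T *m invmx (J *m g *m J^T) *m J = invmx g.
Proof.
move=> ug uJ; have uh : J *m g *m J^T \in unitmx.
  by rewrite !unitmx_mul unitmx_tr ug uJ.
have gPJ : g *m (J^T *m invmx (J *m g *m J^T) *m J) = 1%:M.
  have : J *m (g *m (J^T *m invmx (J *m g *m J^T) *m J)) = J.
    by rewrite !mulmxA mulmxV// mul1mx.
  by move/(congr1 (mulmx (invmx J))); rewrite mulKmx// mulVmx.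
by rewrite -[LHS](mulKmx ug) gPJ mulmx1.
Qed.

(** Behaviour of the contracted Christoffel symbols under a change of coordinates
    with Jacobian J and Hessian H.  The three terms of the derivative of the new
    metric J g J^T come from H, H and the derivative of g.  In the trace part of
    the Christoffel symbol the two Hessian terms are equal, and together they
    cancel one of the two Hessian terms of the first part, because H is symmetric.
    The surviving one gives the inhomogeneous term. *)
Lemma christoffel_trace_transform g J D H (P := invmx (J *m g *m J^T)) :
  g \in unitmx -> J \in unitmx -> g^T = g ->
  (forall a b c, H a b c = H b a c) ->
  christoffel_trace P (fun a => H a *m g *m J^T + J *m g *m (H a)^T
      + J *m (\sum_m J a m *: D m) *m J^T) *m P *m J =
  \sum_b row b P *m H b + christoffel_trace (invmx g) D *m invmx g.
Proof.
move=> ug uJ gs Hs.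
have Ps : P^T = P by rewrite trmx_inv !trmx_mul trmxK gs mulmxA.
have PJ : J^T *m P *m J = invmx g by exact: invmx_congr.
set q := \sum_b row b P *m H b.
pose S a := \sum_m J a m *: D m.
have first : \sum_b row b P *m (H b *m g *m J^T) = q *m g *m J^T.
  by rewrite /q !mulmx_suml; apply: eq_bigr => b _; rewrite !mulmxA.
have second d : (\sum_b row b P *m (J *m g *m (H b)^T)) 0 d = \tr (P *m (H d *m g *m J^T)).
  have -> : \tr (P *m (H d *m g *m J^T)) = \tr ((P *m J *m g) *m (H d)^T).
    rewrite -mxtrace_tr !trmx_mul trmxK gs Ps mxtrace_mulC.
    by rewrite !mulmxA.
  rewrite summxE /mxtrace; apply: eq_bigr => b _; rewrite !mulmxA -!row_mul !mxE.
  by apply: eq_bigr => j _; rewrite !mxE Hs.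
have second' d : \tr (P *m (J *m g *m (H d)^T)) = \tr (P *m (H d *m g *m J^T)).
  rewrite -[RHS]mxtrace_tr !trmx_mul trmxK gs Ps mxtrace_mulC.
  by rewrite !mulmxA.
have third : \sum_b row b P *m (J *m S b *m J^T) = (\sum_m row m (invmx g) *m D m) *m J^T.
  rewrite mulmx_suml.
  transitivity (\sum_b \sum_m J b m *: (row b P *m J *m D m *m J^T)).
    apply: eq_bigr => b _; rewrite /S !mulmxA mulmx_sumr mulmx_suml.
    by apply: eq_bigr => m _; rewrite -scalemxAr -scalemxAl.
  rewrite exchange_big; apply: eq_bigr => m _ /=.
  transitivity ((\sum_b J b m *: row b P) *m J *m D m *m J^T).
    by rewrite !mulmx_suml; apply: eq_bigr => b _; rewrite -!scalemxAl.
  congr (_ *m _ *m _); rewrite -PJ !row_mul; congr (_ *m _).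
  rewrite -row_mul; apply/rowP => j; rewrite summxE !mxE.
  by apply: eq_bigr => b _; rewrite !mxE.
have third' d : \tr (P *m (J *m S d *m J^T)) = \sum_m J d m * \tr (invmx g *m D m).
  rewrite mxtrace_mulC -!mulmxA mxtrace_mulC -!mulmxA mxtrace_mulC mulmxA.
  rewrite PJ /S mulmx_sumr raddf_sum; apply: eq_bigr => m _ /=.
  by rewrite -scalemxAr linearZ.
have -> : christoffel_trace P (fun a => H a *m g *m J^T + J *m g *m (H a)^T
      + J *m S a *m J^T) = (q *m g + christoffel_trace (invmx g) D) *m J^T.
  rewrite /christoffel_trace mulmxDl mulmxBl -third -first.
  under eq_bigr do rewrite 2!mulmxDr.
  rewrite !big_split /= -!addrA; congr (_ + _); rewrite addrCA; congr (_ + _).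
  apply/rowP => d; rewrite !mxE second !mulmxDr !linearD /= second' third'.
  have -> : \sum_j (2^-1 *: \row_d0 \tr (invmx g *m D d0)) 0 j * J^T j d =
      2^-1 * \sum_m J d m * \tr (invmx g *m D m).
    by rewrite big_distrr; apply: eq_bigr => m _ /=; rewrite !mxE; ring.
  by field.
set X := _ + _; have -> : X *m J^T *m P *m J = X *m (J^T *m P *m J) by rewrite !mulmxA.
rewrite PJ /X mulmxDl; congr (_ + _).
by rewrite -mulmxA mulmxV// mulmx1.
Qed.
End ChristoffelTrace.

Section Laplacian.
Context {R : realType} {n : nat}.
Variables (V : set 'rV[R]_n) (G : 'rV[R]_n -> 'M[R]_n) (y : 'rV[R]_n).
Hypotheses (cV : corner_domain V) (Vy : V y).
Hypothesis G_sym : forall z, V z -> (G z)^T = G z.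
Hypothesis G_det : forall z, V z -> 0 < \det (G z).
Hypothesis G_pd : forall a i j, pd_exists V a (fun z => G z i j) y.

Definition metric_pd a : 'M[R]_n := \matrix_(i, j) pd V a (fun z => G z i j) y.

Let G_unit z : V z -> G z \in unitmx.
Proof. by move=> Vz; rewrite unitmxE unitfE gt_eqF// G_det. Qed.

Let ginv_sym : (ginv G y)^T = ginv G y.
Proof. by rewrite trmx_inv G_sym. Qed.

Let ginvC a b : ginv G y a b = ginv G y b a.
Proof. by rewrite -{1}ginv_sym mxE. Qed.

Let metric_pdC a i j : pd V a (fun z => G z i j) y = pd V a (fun z => G z j i) y.
Proof.
apply: pd_ext => // z; rewrite inE => Vz; by rewrite -{1}(G_sym Vz) mxE.
Qed.

(** The first two terms of the Christoffel symbol contribute equally when they are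
    contracted with the symmetric inverse metric. *)
Lemma contracted_christoffel_upE k :
  contracted_christoffel_up V G k y = (christoffel_trace (ginv G y) metric_pd *m ginv G y) 0 k.
Proof.
rewrite /contracted_christoffel_up /christoffel mxE.
set P := ginv G y.
pose D a i j := pd V a (fun z => G z i j) y.
pose X d := \sum_b \sum_c P b c * D b c d.
have XE d : X d = \sum_b \sum_c P b c * D c b d.
  by rewrite /X exchange_big; apply: eq_bigr => b _; apply: eq_bigr => c _; rewrite ginvC.
transitivity (\sum_d P k d * (X d - 2^-1 * \sum_b \sum_c P b c * D d b c)).
  transitivity (\sum_d \sum_b \sum_c P k d * (P b c * (2^-1 * (D b c d + D c b d - D d b c)))).
    rewrite [RHS]exchange_big; apply: eq_bigr => b _ /=.
    rewrite [RHS]exchange_big; apply: eq_bigr => c _ /=.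
    rewrite 2!big_distrr; apply: eq_bigr => d _ /=; rewrite /D -/P; ring.
  apply: eq_bigr => d _.
  have -> : X d = 2^-1 * X d + 2^-1 * X d by field.
  rewrite {2}XE /X !big_distrr -big_split -sumrB big_distrr; apply: eq_bigr => b _ /=.
  rewrite !big_distrr -big_split -sumrB big_distrr; apply: eq_bigr => c _ /=; ring.
apply: eq_bigr => d _; rewrite ginvC mulrC; congr (_ * _); rewrite christoffel_traceE; congr (_ - _ * _).
  rewrite summxE; apply: eq_bigr => b _; rewrite mxE; apply: eq_bigr => c _.
  by rewrite !mxE.
rewrite /mxtrace; apply: eq_bigr => b _; rewrite mxE; apply: eq_bigr => c _.
by rewrite !mxE metric_pdC.
Qed.

(** Expanding the divergence, the derivative of sqrt det G contributes
    tr (G^-1 dG) / 2 and the derivative of the inverse metric - G^-1 dG G^-1.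
    These are the two parts of the contracted Christoffel symbol. *)
Lemma laplacianE u : Ck V 2 u ->
  laplacian V G u y = - (\sum_a \sum_b ginv G y a b * pd V a (pd V b u) y)
    + \sum_k contracted_christoffel_up V G k y * pd V k u y.
Proof.
move=> hu.
set P := ginv G y; set rho := sqrt_det G y.
have rho0 : rho != 0 by rewrite gt_eqF// sqrtr_gt0 G_det.
have GD a i j : is_pd V a (fun z => G z i j) y (metric_pd a i j).
  by rewrite mxE; exact: pd_existsP.
have term a : pd V a (fun z => sqrt_det G z * \sum_b ginv G z a b * pd V b u z) y =
    rho * (2^-1 * \tr (P *m metric_pd a) * (\sum_b P a b * pd V b u y)
    + \sum_b (- (P *m metric_pd a *m P) a b * pd V b u y + P a b * pd V a (pd V b u) y)).
  have H := is_pdM (is_pd_sqrt_det (GD a) (G_det Vy))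
    (is_pd_sum (s := index_enum 'I_n) (fun b => is_pdM (is_pd_inv cV Vy (GD a) G_unit a b)
       (pd_existsP (Ck_pd_exists a (Ck_pd b hu) Vy)))).
  rewrite (is_pd_pd cV Vy H) -/P -/rho mulrDr; congr (_ + _).
  by rewrite -/(ginv G y) -/P -/(sqrt_det G y) -/rho; ring.
rewrite /laplacian -/rho; under eq_bigr do rewrite term.
rewrite -big_distrr /= mulrA mulNr mulVf// mulN1r -sumrN.
under [X in _ = _ + X]eq_bigr do rewrite contracted_christoffel_upE -/P.
have trE : christoffel_trace P metric_pd *m P =
    \sum_a (row a (P *m metric_pd a *m P) - (2^-1 * \tr (P *m metric_pd a)) *: row a P).
  rewrite /christoffel_trace mulmxBl sumrB mulmx_suml; congr (_ - _).
    by apply: eq_bigr => a _; rewrite -!row_mul.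
  apply/rowP => k; rewrite summxE mxE; apply: eq_bigr => a _.
  by rewrite !mxE.
rewrite trE; under [X in _ = _ + X]eq_bigr do rewrite summxE big_distrl /=.
rewrite [X in _ = _ + X]exchange_big -[X in _ = X + _]sumrN -big_split /=; apply: eq_bigr => a _.
rewrite opprD big_distrr /= -!sumrN -!big_split; apply: eq_bigr => b _ /=.
rewrite !mxE; ring.
Qed.

Lemma laplacian_ext u v : {in V, u =1 v} -> Ck V 2 u ->
  laplacian V G v y = laplacian V G u y.
Proof.
move=> uv hu; rewrite !laplacianE//; last exact: Ck_ext uv hu.
have pdE b z : V z -> pd V b v z = pd V b u z.
  by move=> Vz; apply: pd_ext => //; exact: Ck_pd_exists hu Vz.
rewrite (eq_bigr _ (fun k _ => congr1 _ (pdE k y Vy))).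
rewrite -!sumrN; apply: (congr1 (+%R^~ _)); apply: eq_bigr => a _; congr (- _).
apply: eq_bigr => b _; congr (_ * _).
apply: pd_ext => //; last exact: Ck_pd_exists (Ck_pd b hu) Vy.
by move=> z; rewrite inE => Vz; rewrite pdE.
Qed.

Lemma laplacianM u f : Ck V 2 u -> Ck V 2 f ->
  laplacian V G (fun z => u z * f z) y = u y * laplacian V G f y
    + f y * laplacian V G u y
    - 2 * \sum_a \sum_b ginv G y a b * pd V a u y * pd V b f y.
Proof.
move=> hu hf.
have pdM a z : V z -> is_pd V a (fun z => u z * f z) z (pd V a u z * f z + u z * pd V a f z).
  by move=> Vz; exact: is_pdM (pd_existsP (Ck_pd_exists a hu Vz)) (pd_existsP (Ck_pd_exists a hf Vz)).
have pdE a z (Vz : V z) := is_pd_pd cV Vz (pdM a z Vz).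
have pd2E a b : pd V a (pd V b (fun z => u z * f z)) y =
    pd V a (pd V b u) y * f y + pd V b u y * pd V a f y
    + (pd V a u y * pd V b f y + u y * pd V a (pd V b f) y).
  have H : is_pd V a (fun z => pd V b u z * f z + u z * pd V b f z) y
     (pd V a (pd V b u) y * f y + pd V b u y * pd V a f y
    + (pd V a u y * pd V b f y + u y * pd V a (pd V b f) y)).
    apply: is_pdD; apply: is_pdM; apply: pd_existsP.
    - exact: Ck_pd_exists (Ck_pd b hu) Vy.
    - exact: Ck_pd_exists hf Vy.
    - exact: Ck_pd_exists hu Vy.
    - exact: Ck_pd_exists (Ck_pd b hf) Vy.
  rewrite -(is_pd_pd cV Vy H); apply: pd_ext => //.
    by move=> z; rewrite inE => Vz; rewrite pdE.
  exact: is_pd_exists H.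
rewrite !laplacianE//; last exact: CkM.
set P := ginv G y.
have -> : 2 * (\sum_a \sum_b P a b * pd V a u y * pd V b f y) =
    \sum_a \sum_b P a b * (pd V b u y * pd V a f y + pd V a u y * pd V b f y).
  rewrite mulrDl mul1r [X in X + _]exchange_big -big_split /=; apply: eq_bigr => a _.
  by rewrite -big_split; apply: eq_bigr => b _ /=; rewrite [P b a]ginvC; ring.
have E2 : \sum_a \sum_b P a b * pd V a (pd V b (fun z => u z * f z)) y =
    f y * (\sum_a \sum_b P a b * pd V a (pd V b u) y)
    + u y * (\sum_a \sum_b P a b * pd V a (pd V b f) y)
    + \sum_a \sum_b P a b * (pd V b u y * pd V a f y + pd V a u y * pd V b f y).
  rewrite !big_distrr -!big_split; apply: eq_bigr => a _ /=.
  rewrite !big_distrr -!big_split; apply: eq_bigr => b _ /=.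
  rewrite pd2E; move: (P a b) (pd V a _ y) (pd V a _ y) (u y) (f y) => p c d c0 d0.
  move: (pd V a u y) (pd V a f y) (pd V b u y) (pd V b f y) => ua fa ub fb; ring.
have E1 : \sum_k contracted_christoffel_up V G k y * pd V k (fun z => u z * f z) y =
    f y * (\sum_k contracted_christoffel_up V G k y * pd V k u y)
    + u y * (\sum_k contracted_christoffel_up V G k y * pd V k f y).
  rewrite !big_distrr -!big_split; apply: eq_bigr => k _ /=.
  by rewrite pdE//; ring.
rewrite E1 E2; move: (\sum_a _) (\sum_a _) (\sum_a _) => s1 s2 s3.
move: (\sum_k _) (\sum_k _) (u y) (f y) => s4 s5 c d; ring.
Qed.

(** The zeroth-order term acts by multiplication, so that it is absorbed, whatever
    its coefficient, in the operator applied to f. *)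
Lemma conformal_laplacianM u f : Ck V 2 u -> Ck V 2 f ->
  conformal_laplacian V G (fun z => u z * f z) y = u y * conformal_laplacian V G f y
    + f y * laplacian V G u y
    - 2 * \sum_a \sum_b ginv G y a b * pd V a u y * pd V b f y.
Proof.
move=> hu hf; rewrite /conformal_laplacian laplacianM//.
move: (laplacian _ _ _ _) (laplacian _ _ _ _) (scalar_curvature _ _ _) => s1 s2 s3.
move: (\sum_a _) (_ / _) (u y) (f y) => s4 s5 c d; ring.
Qed.

Lemma Ck_cst k c : Ck V k (fun=> c).
Proof.
elim: k c => [|k IH] c; first by apply: Ck0 => x; exact: cvg_cst.
apply: CkS => [x|a z Vz|a].
- exact: cvg_cst.
- exact: is_pd_exists (is_pd_cst V z a c).
- apply: Ck_ext (IH 0) => // z; rewrite inE => Vz.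
  by rewrite (is_pd_pd cV Vz (is_pd_cst V z a c)).
Qed.

Lemma Ck_coord k (j : 'I_n) : Ck V k (fun z => z 0 j).
Proof.
have cc : {within V, continuous (fun z : 'rV[R]_n => z 0 j)}.
  by apply: continuous_subspaceT => z; exact: coord_continuous.
case: k => [|k]; first exact: Ck0.
apply: CkS => // [a z Vz|a].
- exact: is_pd_exists (is_pd_coord V z a j).
- apply: (Ck_ext cV _ (@Ck_cst k (a == j)%:R)) => z; rewrite inE => Vz.
  by rewrite (is_pd_pd cV Vz (is_pd_coord V z a j)).
Qed.

Lemma laplacian_coord k : laplacian V G (fun z => z 0 k) y = contracted_christoffel_up V G k y.
Proof.
rewrite laplacianE; last exact: Ck_coord.
have p1 a z : V z -> pd V a (fun z => z 0 k) z = (a == k)%:R.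
  by move=> Vz; exact: (is_pd_pd cV Vz (is_pd_coord V z a k)).
rewrite [X in - X + _]big1 => [|a _]; last first.
  rewrite big1 // => b _; rewrite (_ : pd V a _ y = 0) ?mulr0//.
  rewrite -(is_pd_pd cV Vy (is_pd_cst V y a ((b == k)%:R))).
  apply: pd_ext => //; last exact: is_pd_exists (is_pd_cst V y a _).
  by move=> z; rewrite inE => Vz; rewrite p1.
rewrite oppr0 add0r (bigD1 k)//= p1// eqxx mulr1 big1 ?addr0// => a /negPf ak.
by rewrite p1// ak mulr0.
Qed.

(** The Laplacian of a coordinate is a contracted Christoffel symbol; so the
    vanishing of L (z_k f), given L f = 0, is the condition
    f Gamma^k = 2 g^kb d_b f. *)
Lemma conformal_laplacian_coordM k f : Ck V 2 f ->
  conformal_laplacian V G (fun z => z 0 k * f z) y =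
    y 0 k * conformal_laplacian V G f y
    + (f y * contracted_christoffel_up V G k y - 2 * \sum_b ginv G y k b * pd V b f y).
Proof.
move=> hf; rewrite conformal_laplacianM//; last exact: Ck_coord.
rewrite laplacian_coord addrA; congr (_ - 2 * _).
have p1 a : pd V a (fun z => z 0 k) y = (a == k)%:R.
  exact: (is_pd_pd cV Vy (is_pd_coord V y a k)).
rewrite (bigD1 k)//= [X in _ + X]big1 ?addr0 => [|a /negPf ak].
  by apply: eq_bigr => b _; rewrite p1 eqxx mulr1.
by rewrite big1// => b _; rewrite p1 ak mulr0 mul0r.
Qed.

End Laplacian.

(** * Change of coordinates *)

Section ChangeOfCoordinates.
Context {R : realType} {n : nat}.

Lemma is_pd_mulmx (V : set 'rV[R]_n) (y : 'rV[R]_n) (a : 'I_n) (p q r : nat)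
    (A : 'rV[R]_n -> 'M[R]_(p, q)) (B : 'rV[R]_n -> 'M[R]_(q, r))
    (A' : 'M[R]_(p, q)) (B' : 'M[R]_(q, r)) :
  (forall i j, is_pd V a (fun z => A z i j) y (A' i j)) ->
  (forall i j, is_pd V a (fun z => B z i j) y (B' i j)) ->
  forall i j, is_pd V a (fun z => (A z *m B z) i j) y ((A' *m B y + A y *m B') i j).
Proof.
move=> hA hB i j; under eq_fun do rewrite mxE.
rewrite !mxE -big_split; apply: is_pd_sum => k; exact: is_pdM.
Qed.

Arguments is_pd_mulmx [V y a p q r A B A' B'] _ _ i j.

Variables (V V' : set 'rV[R]_n) (tau : 'rV[R]_n -> 'rV[R]_n).
Variables (G K : 'rV[R]_n -> 'M[R]_n).
Hypotheses (cV : corner_domain V) (cV' : corner_domain V').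
Hypothesis tauV : forall z, V z -> V' (tau z).
Hypothesis tau_C2 : forall i, Ck V 2 (fun z => tau z 0 i).
Hypothesis G_C1 : forall i j, Ck V' 1 (fun z => G z i j).
Hypothesis G_sym : forall z, V' z -> (G z)^T = G z.
Hypothesis G_det : forall z, V' z -> 0 < \det (G z).
Hypothesis K_det : forall z, V z -> 0 < \det (K z).

Definition partials_mx z : 'M[R]_n := \matrix_(a, i) pd V a (fun z => tau z 0 i) z.

Hypothesis KE : forall z, V z -> K z = partials_mx z *m G (tau z) *m (partials_mx z)^T.

Variable y : 'rV[R]_n.
Hypothesis Vy : V y.

Let K_sym z : V z -> (K z)^T = K z.
Proof. by move=> Vz; rewrite KE// !trmx_mul trmxK G_sym ?mulmxA//; exact: tauV. Qed.

Let partials_mx_unit : partials_mx y \in unitmx.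
Proof.
have : K y \in unitmx by rewrite unitmxE unitfE gt_eqF// K_det.
by rewrite KE// !unitmx_mul => /andP[/andP[]].
Qed.

Let G_unit : G (tau y) \in unitmx.
Proof. by rewrite unitmxE unitfE gt_eqF// G_det//; exact: tauV. Qed.

Let hessian a : 'M[R]_n := \matrix_(c, i) pd V a (pd V c (fun z => tau z 0 i)) y.

Let K_pd a i j : is_pd V a (fun z => K z i j) y
  ((hessian a *m G (tau y) *m (partials_mx y)^T + partials_mx y *m G (tau y) *m (hessian a)^T
   + partials_mx y *m (\sum_m partials_mx y a m *: metric_pd V' G (tau y) m) *m (partials_mx y)^T) i j).
Proof.
have J_pd c i0 : is_pd V a (fun z => partials_mx z c i0) y (hessian a c i0).
  rewrite mxE; under eq_fun do rewrite mxE.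
  exact: pd_existsP (Ck_pd_exists a (Ck_pd c (tau_C2 i0)) Vy).
have JT_pd c i0 : is_pd V a (fun z => (partials_mx z)^T c i0) y ((hessian a)^T c i0).
  by rewrite mxE; under eq_fun do rewrite mxE; exact: J_pd.
have G_pd i0 j0 : is_pd V a (fun z => G (tau z) i0 j0) y
    ((\sum_m partials_mx y a m *: metric_pd V' G (tau y) m) i0 j0).
  have H := is_pd_chain cV' (G_C1 i0 j0) Vy tauV
     (fun k => pd_existsP (Ck_pd_exists a (tau_C2 k) Vy)).
  move: H; congr (is_pd _ _ _ _ _); rewrite summxE; apply: eq_bigr => m _.
  by rewrite !mxE mulrC.
have H := is_pd_mulmx (is_pd_mulmx J_pd G_pd) JT_pd i j.
apply: (is_pd_ext Vy (u := fun z => (partials_mx z *m G (tau z) *m (partials_mx z)^T) i j)).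
  by move=> z; rewrite inE => Vz; rewrite KE.
move: H; congr (is_pd _ _ _ _ _).
by rewrite mulmxDl addrAC.
Qed.

Let ginvK : (partials_mx y)^T *m ginv K y *m partials_mx y = ginv G (tau y).
Proof.
by rewrite /ginv KE//; exact: invmx_congr.
Qed.

Lemma transition_metric_pd_exists a i j : pd_exists V a (fun z => K z i j) y.
Proof. exact: is_pd_exists (@K_pd a i j). Qed.

(** The invariance of the Laplacian under the change of coordinates tau, applied to
    the new coordinates themselves: their Laplacian in the new coordinates is the
    right-hand side.  In the old coordinates,
    their second derivatives cancel against the inhomogeneous term in the
    transformation of the Christoffel symbols. *)
Lemma laplacian_transition k :
  laplacian V K (fun z => tau z 0 k) y = contracted_christoffel_up V' G k (tau y).
Proof.
rewrite laplacianE//; last by move=> a i j; exact: is_pd_exists (@K_pd a i j).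
have KpdE : metric_pd V K y = fun a => hessian a *m G (tau y) *m (partials_mx y)^T
   + partials_mx y *m G (tau y) *m (hessian a)^T
   + partials_mx y *m (\sum_m partials_mx y a m *: metric_pd V' G (tau y) m) *m (partials_mx y)^T.
  by apply/funext => a; apply/matrixP => i j; rewrite mxE (is_pd_pd cV Vy (@K_pd a i j)).
have -> : \sum_c contracted_christoffel_up V K c y * pd V c (fun z => tau z 0 k) y =
    (christoffel_trace (ginv K y) (metric_pd V K y) *m ginv K y *m partials_mx y) 0 k.
  rewrite [RHS]mxE; apply: eq_bigr => c _; rewrite [partials_mx _ _ _]mxE.
  rewrite contracted_christoffel_upE//.
  by move=> a i j; exact: is_pd_exists (@K_pd a i j).
rewrite KpdE {2 3}/ginv KE// christoffel_trace_transform//; last 2 first.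
- by apply: G_sym; exact: tauV.
- by move=> a b c; rewrite mxE [RHS]mxE; exact: (pdC cV _ _ (tau_C2 c) Vy).
rewrite -KE// mxE addrA contracted_christoffel_upE//; last 2 first.
- by exact: tauV.
- by move=> a i j; exact: Ck_pd_exists (G_C1 i j) (tauV Vy).
rewrite -[RHS]add0r; congr (_ + _); rewrite summxE.
apply/eqP; rewrite addrC subr_eq0; apply/eqP; apply: eq_bigr => a _.
by rewrite mxE; apply: eq_bigr => b _; rewrite !mxE.
Qed.

(** Both sides are the inner product of the gradients of the k-th new coordinate
    and of f. *)
Lemma gradient_transition f k : Ck V' 1 f ->
  \sum_a \sum_b ginv K y a b * pd V a (fun z => tau z 0 k) y * pd V b (fun z => f (tau z)) y =
  \sum_j ginv G (tau y) k j * pd V' j f (tau y).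
Proof.
move=> hf.
have fE b : pd V b (fun z => f (tau z)) y = \sum_j pd V' j f (tau y) * partials_mx y b j.
  have H := is_pd_chain cV' hf Vy tauV
     (fun k => pd_existsP (Ck_pd_exists b (tau_C2 k) Vy)).
  by rewrite (is_pd_pd cV Vy H); apply: eq_bigr => j _; rewrite mxE.
transitivity (\sum_a \sum_b \sum_j ginv K y a b * partials_mx y a k * (pd V' j f (tau y) * partials_mx y b j)).
  apply: eq_bigr => a _; apply: eq_bigr => b _; rewrite fE big_distrr.
  by apply: eq_bigr => j _ /=; rewrite [partials_mx y a k]mxE.
rewrite exchange_big; under eq_bigr do rewrite exchange_big; rewrite exchange_big.
apply: eq_bigr => j _ /=; rewrite -ginvK [(_ *m _) k j]mxE big_distrl; apply: eq_bigr => b _ /=.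
rewrite [(_ *m _) k b]mxE !big_distrl; apply: eq_bigr => a _ /=.
rewrite [_^T k a]mxE; ring.
Qed.

End ChangeOfCoordinates.

(** * The metric in charts *)

Section MetricInCharts.
Context {R : realType} {n : nat} {r : R} {M : topologicalType}.
Context {X : manifold n (r + 1) M}.
Variable g : metric X.
Hypothesis hr : 2 < r.
Implicit Types phi Z : chart (R := R) n M.

Lemma Creal_Ck (V : set 'rV[R]_n) (s : R) k u : k%:R <= s -> Creal V s u -> Ck V k u.
Proof.
move=> ks [+ _]; apply: Ck_leq.
by rewrite truncn_ge_nat// (le_trans _ ks).
Qed.

Lemma comp_C1 phi a b : atlas X phi ->
  Ck (range_on phi setT) 1 (fun y => Defs.comp g phi y a b).
Proof. by move=> hphi; apply: Creal_Ck (comp_Cr g hphi a b); rewrite ltW// (lt_trans _ hr)// ltr_nat. Qed.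

Lemma comp_det_gt0 phi y : atlas X phi -> range_on phi setT y -> 0 < \det (Defs.comp g phi y).
Proof. by move=> hphi Vy; apply: posdef_det_gt0; exact: comp_pos hphi _ Vy. Qed.

Lemma range_onW phi A y : range_on phi A y -> range_on phi setT y.
Proof. by move=> [p [dp _] py]; exists p. Qed.

Lemma range_on_cdom Z : range_on Z (cdom Z) = range_on Z setT.
Proof. by rewrite /range_on setIid setIT. Qed.

Section Logarithm.
Variables (Z : chart (R := R) n M) (f : M -> R).
Hypotheses (hZ : atlas X Z) (f_C2 : C2_on (X := X) (cdom Z) f).
Hypothesis f_gt0 : forall p, cdom Z p -> 0 < f p.

Lemma C2_on_cdom : Ck (range_on Z setT) 2 (f \o cinv Z).
Proof. by have := f_C2 hZ; rewrite range_on_cdom. Qed.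

(** Lowering the index by the metric and dividing by f turn
    f Gamma^k = 2 g^kb d_b f into Gamma_a = 2 d_a log f. *)
Lemma Gamma_low_log p : cdom Z p ->
  (forall a, Gamma_low g Z a p = 2 * coord_pd Z a (fun q => ln (f q)) p) <->
  (forall k, f p * contracted_christoffel_up (range_on Z setT) (Defs.comp g Z) k (cmap Z p) =
    2 * \sum_b ginv (Defs.comp g Z) (cmap Z p) k b *
      pd (range_on Z setT) b (f \o cinv Z) (cmap Z p)).
Proof.
move=> dp; set W := range_on Z setT; set G := Defs.comp g Z; set y := cmap Z p.
have Wy : W y by exists p.
have cW : corner_domain W by apply: range_on_corner; exact: openT.
have fp : f p != 0 by rewrite gt_eqF// f_gt0.
have Gu : G y \in unitmx by rewrite unitmxE unitfE gt_eqF// comp_det_gt0.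
pose x : 'cV[R]_n := \col_b contracted_christoffel_up W G b y.
pose w : 'cV[R]_n := \col_b (2 / f p * pd W b (f \o cinv Z) y).
have lnE a : 2 * coord_pd Z a (fun q => ln (f q)) p = w a 0.
  rewrite mxE /coord_pd.
  have fy0 : 0 < (f \o cinv Z) y by rewrite /= /y cmapK// f_gt0.
  have := is_pd_comp (is_derive1_ln fy0) (pd_existsP (Ck_pd_exists a C2_on_cdom Wy)).
  move=> /(is_pd_pd cW Wy) ->.
  by rewrite /= /y cmapK// mulrA.
have lowE a : Gamma_low g Z a p = (G y *m x) a 0.
  by rewrite mxE; apply: eq_bigr => b _; rewrite mxE.
split=> H k.
  have : x = invmx (G y) *m w.
    rewrite -[LHS](mulKmx Gu); congr (_ *m _); apply/colP => a.
    by rewrite -lowE H lnE.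
  move=> /colP/(_ k); rewrite mxE => ->; rewrite mxE !big_distrr; apply: eq_bigr => b _ /=.
  by rewrite mxE; field.
rewrite lowE lnE; suff -> : x = invmx (G y) *m w by rewrite mulKVmx.
apply/colP => j; apply: (mulfI fp); rewrite [x j 0]mxE H [(_ *m _) j 0]mxE !big_distrr.
by apply: eq_bigr => b _ /=; rewrite mxE; field.
Qed.

End Logarithm.

Section Transition.
Variables (phi Z : chart (R := R) n M).
Hypotheses (hphi : atlas X phi) (hZ : atlas X Z) (oZ : open (cdom Z)).
Let V := range_on phi (cdom Z).
Let W := range_on Z setT.
Let tau z := cmap Z (cinv phi z).

Lemma transition_C2 i : Ck V 2 (transition phi Z i).
Proof.
have [H _] := atlas_compatible hphi hZ i.
by apply: Creal_Ck H; rewrite (le_trans (ltW hr))// lerDl.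
Qed.

Lemma transition_range z : V z -> W (tau z).
Proof. by move=> [p [dp Zp] <-]; exists p => //; rewrite /tau cmapK. Qed.

Lemma comp_jacobian z : V z ->
  Defs.comp g phi z = partials_mx V tau z *m Defs.comp g Z (tau z) *m (partials_mx V tau z)^T.
Proof.
move=> Vz; apply/matrixP => a b; rewrite (comp_transform g hphi hZ Vz) exchange_big mxE.
apply: eq_bigr => j _ /=; rewrite mxE big_distrl; apply: eq_bigr => i _ /=.
by rewrite !mxE mulrAC.
Qed.

(** The same expression as in the coordinates Z, but for the operator written in
    an arbitrary chart phi; only the Laplacian and the gradient have to be
    transported from phi to Z. *)
Lemma conformal_laplacian_transitionM (f : M -> R) k p :
  Ck V 2 (f \o cinv phi) -> Ck W 2 (f \o cinv Z) -> cdom phi p -> cdom Z p ->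
  conformal_laplacian V (Defs.comp g phi) (fun z => transition phi Z k z * f (cinv phi z)) (cmap phi p) =
    cmap Z p 0 k * conformal_laplacian V (Defs.comp g phi) (f \o cinv phi) (cmap phi p)
    + (f p * contracted_christoffel_up W (Defs.comp g Z) k (cmap Z p)
       - 2 * \sum_b ginv (Defs.comp g Z) (cmap Z p) k b * pd W b (f \o cinv Z) (cmap Z p)).
Proof.
move=> fphi fZ dphi dZ; set y := cmap phi p.
have Vy : V y by exists p.
have cV : corner_domain V by exact: range_on_corner.
have cW : corner_domain W by apply: range_on_corner; exact: openT.
have tauy : tau y = cmap Z p by rewrite /tau /y cmapK.
have K_det z : V z -> 0 < \det (Defs.comp g phi z).
  by move=> /range_onW; exact: comp_det_gt0.
have K_sym z : V z -> (Defs.comp g phi z)^T = Defs.comp g phi z.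
  by move=> /range_onW; exact: comp_sym.
have G_det z : W z -> 0 < \det (Defs.comp g Z z) by exact: comp_det_gt0.
have G_sym z : W z -> (Defs.comp g Z z)^T = Defs.comp g Z z by exact: comp_sym.
have G_C1 i j := comp_C1 i j hZ.
have K_pd a i j := transition_metric_pd_exists (a := a) (i := i) (j := j)
  cW transition_range transition_C2 G_C1 comp_jacobian Vy.
rewrite (conformal_laplacianM cV Vy K_sym K_det K_pd (transition_C2 k) fphi).
rewrite (laplacian_transition cV cW transition_range transition_C2 G_C1 G_sym G_det
   K_det comp_jacobian Vy k).
have grad := gradient_transition cV cW transition_range transition_C2 G_det
   K_det comp_jacobian Vy k (Ck_leq (leqnSn 1) fZ).
rewrite -tauy -grad {1}/transition -/(tau y) /= [cinv phi y]cmapK// addrA.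
congr (_ - 2 * _); apply: eq_bigr => a _; apply: eq_bigr => b _; congr (_ * _).
have ext : {in V, f \o cinv phi =1 fun z => (f \o cinv Z) (tau z)}.
  by move=> z; rewrite inE => -[q [dq Zq] <-] /=; rewrite /tau !cmapK.
by apply/esym; apply: pd_ext => //; exact: Ck_pd_exists fphi Vy.
Qed.

End Transition.
End MetricInCharts.

Unset Implicit Arguments.
Set Strict Implicit.
Set Printing Implicit Defensive.

(** * The characterization *)

Theorem proposition2p5 (R : realType) (n : nat) (hn : (3 <= n)%N)
    (r : R) (hr : 2 < r) (M : topologicalType)
    (X : manifold n (r + 1) M) (g : metric X)
    (Omega : set M) (hOmega : open Omega)
    (Z : chart n M) (hZ : coordinates_on (X := X) Omega Z) :
  conformal_harmonic g Omega Z <->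
  exists f : M -> R,
    [/\ C2_on (X := X) Omega f,
        forall p, Omega p -> 0 < f p,
        Lg_zero_on g Omega f &
        forall a p, Omega p ->
          Gamma_low g Z a p = 2 * coord_pd Z a (fun q => ln (f q)) p].
Proof.
have [aZ dZ] := hZ; move: hOmega; rewrite -dZ => oZ.
split.
  move=> [f [F [fC2 FC2 f0 [Lf LF] ZE]]]; exists f; split => // a p dp.
  move: a; apply/(Gamma_low_log g aZ fC2 f0 dp) => k.
  set W := range_on Z setT; set y := cmap Z p.
  have Wy : W y by exists p.
  have cW : corner_domain W by apply: range_on_corner; exact: openT.
  have fZ := C2_on_cdom aZ fC2.
  have G_det z : W z -> 0 < \det (Defs.comp g Z z) by exact: comp_det_gt0.
  have G_sym z : W z -> (Defs.comp g Z z)^T = Defs.comp g Z z by exact: comp_sym.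
  have G_pd a i j := Ck_pd_exists a (comp_C1 g hr i j aZ) Wy.
  have FE : {in W, F k \o cinv Z =1 fun z => z 0 k * (f \o cinv Z) z}.
    move=> z; rewrite inE => -[q [dq _] <-] /=; rewrite cmapK// ZE// divfK//.
    by rewrite gt_eqF// f0.
  have := LF k Z aZ p dp dp; have := Lf Z aZ p dp dp.
  rewrite /Lg range_on_cdom -/W -/y => Lf0.
  rewrite /conformal_laplacian -(laplacian_ext cW Wy G_sym G_det G_pd FE (C2_on_cdom aZ (FC2 k))).
  rewrite FE ?inE// -/(conformal_laplacian _ _ _ _).
  rewrite (conformal_laplacian_coordM cW Wy G_sym G_det G_pd k fZ) Lf0 mulr0 add0r.
  by move=> /eqP; rewrite subr_eq0 => /eqP; rewrite /= /y cmapK.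
move=> [f [fC2 f0 Lf Gam]].
exists f, (fun k p => cmap Z p 0 k * f p); split => //.
- move=> k phi aphi; have cV : corner_domain (range_on phi (cdom Z)) by exact: range_on_corner.
  exact: (CkM cV (transition_C2 hr aphi aZ k) (fC2 phi aphi)).
- split=> // k phi aphi p Zp dp.
  have /(Gamma_low_log g aZ fC2 f0 Zp) E : forall a,
    Gamma_low g Z a p = 2 * coord_pd Z a (fun q => ln (f q)) p by move=> a; exact: Gam.
  have L := Lf phi aphi p Zp dp.
  rewrite /Lg in L *.
  rewrite [LHS](conformal_laplacian_transitionM g hr aphi aZ oZ k (fC2 phi aphi) (C2_on_cdom aZ fC2) dp Zp).
  by rewrite L mulr0 add0r E subrr.
- by move=> k p Zp; rewrite mulfK// gt_eqF// f0.
Qed.
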